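(* Let $0\le n\le N$ and let $v_h^n,v_h^{*,n}$ be given by the fully-discrete scheme (stated in the context). Set $\widetilde{Pv(t_n)}:=Pv(t_n)/\|Pv(t_n)\|$, $\xi_v^n:=\widetilde{Pv(t_n)}-v_h^n$ and $\xi_v^{*,n}:=\widetilde{Pv(t_n)}-v_h^{*,n}$. If $$\big(\widetilde{Pv(t_n)},\,\widetilde{Pv(t_n)}-v_h^n\big)\le1,$$ then $$\|\xi_v^n\|\le\|\xi_v^{*,n}\|+\|\xi_v^{*,n}\|^3.$$
   Context: $\Omega\subset\mathbb R^d$ ($1\le d\le3$) is a bounded domain with smooth boundary; $(\cdot,\cdot)$, $\|\cdot\|$ are the $L^2(\Omega)$ inner product and norm; $\beta,\gamma,T>0$ are fixed, $f:\mathbb R\to\mathbb R$ is differentiable with $f,f'$ locally Lipschitz. The initial data are $u_0,v_0\in H^2(\Omega)\cap H^1_0(\Omega)$ with $\|v_0\|=1$. $(u,v)$ is the solution on $\Omega\times[0,T]$ of $$u_t=\beta\big(\Delta u+f(u)-2v(v,\Delta u+f(u))\big),\qquad v_t=\gamma\big(\Delta v+f'(u)v-v(v,\Delta v+f'(u)v)\big),$$ with $u(0)=u_0$, $v(0)=v_0$ and $u=v=0$ on $\partial\Omega$. For mesh size $h$, $S_h\subset H^1_0(\Omega)$ is the space of continuous piecewise linear functions on a quasi-uniform partition of $\Omega$ of mesh size $h$, and $P:H^1_0(\Omega)\to S_h$ is the elliptic projection, $(\nabla(g-Pg),\nabla\chi)=0$ for all $\chi\in S_h$; it is assumed that $Pv(t_n)\neq0$.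 Let $N$ be a positive integer, $\tau=T/N$, $t_n=n\tau$. Fully-discrete scheme: with $u_h^0=Pu_0$ and $v_h^0=v_h^{*,0}=Pv_0/\|Pv_0\|$, for $n=1,\dots,N$ find $u_h^n,v_h^{*,n},v_h^n\in S_h$ such that for all $\chi_1,\chi_2\in S_h$ $$\beta^{-1}\Big(\frac{u_h^n-u_h^{n-1}}{\tau},\chi_1\Big)+(\nabla u_h^n,\nabla\chi_1)-2(v_h^{n-1},\chi_1)(\nabla v_h^{n-1},\nabla u_h^n)=(f(u_h^{n-1}),\chi_1)-2(v_h^{n-1},\chi_1)(f(u_h^{n-1}),v_h^{n-1}),$$ $$\gamma^{-1}\Big(\frac{v_h^{*,n}-v_h^{n-1}}{\tau},\chi_2\Big)+(\nabla v_h^{*,n},\nabla\chi_2)-(v_h^{n-1},\chi_2)(\nabla v_h^{n-1},\nabla v_h^{*,n})=(f'(u_h^{n-1})v_h^{n-1},\chi_2)-(v_h^{n-1},\chi_2)(f'(u_h^{n-1})v_h^{n-1},v_h^{n-1}),$$ $$v_h^n=v_h^{*,n}/\|v_h^{*,n}\|$$ (so in particular $\|v_h^n\|=1$ and $v_h^{*,n}=\|v_h^{*,n}\|v_h^n$). *)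

(* Defs.v *)
From HB Require Import structures.
From mathcomp Require Import all_boot all_order all_algebra.
From mathcomp Require Import all_classical all_reals all_analysis.
From mathcomp Require Import lra.

Set Implicit Arguments.
Unset Strict Implicit.
Unset Printing Implicit Defensive.

Import Order.TTheory GRing.Theory Num.Theory.
Import numFieldNormedType.Exports.

Local Open Scope classical_set_scope.
Local Open Scope ring_scope.

(* R^d with its Borel sigma-algebra *)
Notation borelRn R d := (g_sigma_algebraType (@open 'rV[R]_d)).

Section tuple_lebesgue.
Context {R : realType}.
Local Notation tupleRn n := (n.-tuple (measurableTypeR R)).

Definition consp n (p : measurableTypeR R * tupleRn n) : tupleRn n.+1 :=
  [tuple of p.1 :: p.2].
Definition unconsp n (t : tupleRn n.+1) : measurableTypeR R * tupleRn n :=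
  (thead t, [tuple of behead t]).

Lemma unconspK n : cancel (@unconsp n) (@consp n).
Proof. by move=> t; rewrite [RHS]tuple_eta. Qed.

Lemma conspK n : cancel (@consp n) (@unconsp n).
Proof.
move=> [x t]; rewrite /unconsp /consp /= theadE; congr pair.
exact/val_inj.
Qed.

Lemma measurable_consp n : measurable_fun [set: _] (@consp n).
Proof. exact: (measurable_cons measurable_fst measurable_snd). Qed.

Lemma measurable_unconsp n : measurable_fun [set: _] (@unconsp n).
Proof.
apply/measurable_fun_pairP; split => /=.
  exact: (measurable_tnth ord0).
exact: measurable_behead.
Qed.

Section step.
Variables (n : nat) (m : {sigma_finite_measure set (tupleRn n) -> \bar R}).

Definition tleb_step : set (tupleRn n.+1) -> \bar R :=
  pushforward (lebesgue_measure \x m)%E (@consp n).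

Let step0 : tleb_step set0 = 0%E.
Proof. by rewrite /tleb_step /pushforward preimage_set0 measure0. Qed.

Let step_ge0 A : (0 <= tleb_step A)%E.
Proof. exact: (measure_ge0 (lebesgue_measure \x m)%E). Qed.

Let step_sigma_additive : semi_sigma_additive tleb_step.
Proof.
exact: (@measure_semi_sigma_additive _ _ _
  (measure_function_pushforward__canonical__measure_function_Measure
     (lebesgue_measure \x m)%E (@measurable_consp n))).
Qed.

HB.instance Definition _ :=
  isMeasure.Build _ _ _ tleb_step step0 step_ge0 step_sigma_additive.

Let step_sigma_finite : sigma_finite [set: tupleRn n.+1] tleb_step.
Proof.
have /sigma_finiteP[F [TF ndF Foo]] := sigma_finiteT (@lebesgue_measure R).
have /sigma_finiteP[G [TG ndG Goo]] := sigma_finiteT m.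
exists (fun k => @unconsp n @^-1` (F k `*` G k)).
  rewrite -preimage_bigcup (_ : \bigcup_k _ = setT) ?preimage_setT//.
  rewrite -subTset => -[x y] _.
  have [i _ Fix] : (\bigcup_i F i) x by rewrite -TF.
  have [j _ Gjy] : (\bigcup_i G i) y by rewrite -TG.
  exists (maxn i j) => //; split => /=.
  - by move: x Fix; exact/subsetPset/ndF/leq_maxl.
  - by move: y Gjy; exact/subsetPset/ndG/leq_maxr.
move=> k; have [mF Fk] := Foo k; have [mG Gk] := Goo k.
have mFG : measurable (F k `*` G k) by exact: measurableX.
split; first by rewrite -[X in measurable X]setTI; exact: measurable_unconsp.
rewrite /tleb_step /pushforward -comp_preimage.
rewrite (_ : _ \o _ = id); last by apply/funext => p /=; rewrite conspK.
by rewrite preimage_id product_measure1E// lte_mul_pinfty// ge0_fin_numE.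
Qed.

HB.instance Definition _ :=
  Measure_isSigmaFinite.Build _ _ _ tleb_step step_sigma_finite.

End step.

Fixpoint tuple_lebesgue n : {sigma_finite_measure set (tupleRn n) -> \bar R} :=
  match n with
  | 0%N => \d_([tuple] : tupleRn 0)
  | n'.+1 => tleb_step (tuple_lebesgue n')
  end.

End tuple_lebesgue.

Section lebesgue_Rn.
Context {R : realType} {d : nat}.
Local Notation tupleRd := (d.-tuple (measurableTypeR R)).

Definition row_of_tuple (t : tupleRd) : borelRn R d := \row_i tnth t i.

Let box (p : {ffun 'I_d -> rat} * rat) : set 'rV[R]_d :=
  [set x | forall i, ball (ratr (p.1 i) : R) (ratr p.2) (x 0 i)].

Let open_bigcup_box (U : set 'rV[R]_d) : open U ->
  U = \bigcup_p (if `[< box p `<=` U >] then box p else set0).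
Proof.
move=> oU; apply/seteqP; split => [x Ux|x [p _]]; last first.
  by case: asboolP => // + ?; exact.
have /nbhs_ballP[e /= e0 xeU] : nbhs x U by exact: open_nbhs_nbhs.
have e20 : 0 < e / 2 by rewrite divr_gt0.
have [r] := rat_in_itvoo e20; rewrite in_itv/= => /andP[r0 re].
have qP i : {q : rat | ratr q \in `]x 0 i - ratr r, x 0 i + ratr r[}.
  apply/cid; apply: rat_in_itvoo.
  by rewrite -subr_gt0 opprD opprK addrACA subrr add0r addr_gt0.
pose q := [ffun i => sval (qP i)].
exists (q, r) => //; rewrite asboolT.
  move=> i /=; rewrite /ball/= ffunE; have := svalP (qP i).
  rewrite in_itv/= => /andP[q1 q2].
  by rewrite ltr_distl; apply/andP; split; lra.
move=> y yq; apply: xeU; split => // i j; rewrite ord1 /ball/=.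
have := yq j; rewrite /ball/= ffunE; have := svalP (qP j).
rewrite in_itv/= => /andP[q1 q2]; rewrite !ltr_distl => /andP[y1 y2].
by apply/andP; split; lra.
Qed.

Lemma measurable_row_of_tuple : measurable_fun [set: tupleRd] row_of_tuple.
Proof.
apply: (@measurability _ _ tupleRd (borelRn R d) setT row_of_tuple
  (@open 'rV[R]_d) erefl) => _ [U oU <-].
rewrite setTI (open_bigcup_box oU) preimage_bigcup.
apply: countable_bigcupT_measurable => [|p]; first exact: countableP.
case: asboolP => _; last first.
  by rewrite preimage_set0.
rewrite (_ : _ @^-1` _ = \bigcap_(i in [set: 'I_d])
  (@tnth d _ ^~ i) @^-1` ball (ratr (p.1 i) : R) (ratr p.2)).
  apply: fin_bigcap_measurable => // i _.
  rewrite -[X in measurable X]setTI; apply: measurable_tnth => //.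
  rewrite ball_itv; exact: measurable_itv.
apply/seteqP; split => t /= tp i; first by move=> _; have := tp i; rewrite mxE.
by rewrite mxE; exact: tp.
Qed.

(* d-dimensional Lebesgue measure on the Borel sets: the d-fold product of the
   one-dimensional one, transported from tuples to row vectors. *)
Definition lebesgue_Rn : set (borelRn R d) -> \bar R :=
  pushforward (tuple_lebesgue d) row_of_tuple.

Let lebesgue_Rn0 : lebesgue_Rn set0 = 0%E.
Proof. by rewrite /lebesgue_Rn /pushforward preimage_set0 measure0. Qed.

Let lebesgue_Rn_ge0 A : (0 <= lebesgue_Rn A)%E.
Proof. exact: (measure_ge0 (tuple_lebesgue d)). Qed.

Let lebesgue_Rn_sigma_additive : semi_sigma_additive lebesgue_Rn.
Proof.
exact: (@measure_semi_sigma_additive _ _ _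
  (measure_function_pushforward__canonical__measure_function_Measure
     (tuple_lebesgue d) measurable_row_of_tuple)).
Qed.

HB.instance Definition _ := isMeasure.Build _ _ _ lebesgue_Rn
  lebesgue_Rn0 lebesgue_Rn_ge0 lebesgue_Rn_sigma_additive.

End lebesgue_Rn.
Arguments lebesgue_Rn : clear implicits.

(* Elements of L^2(Omega), H^1(Omega), ... are represented by total functions on
   R^d, of which only the restriction to Omega (up to null sets) matters. *)
Section function_spaces.
Context {R : realType} {d : nat}.
Implicit Types (Omega A : set 'rV[R]_d) (phi psi eta g : 'rV[R]_d -> R).

Definition ip Omega phi psi : R :=
  \int[lebesgue_Rn R d]_(x in Omega) (phi x * psi x).

Definition nrm Omega phi : R := Num.sqrt (ip Omega phi phi).

Definition eq_L2 Omega phi psi : Prop :=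
  {ae lebesgue_Rn R d, forall x, Omega x -> phi x = psi x}.

Definition L2 Omega phi : Prop :=
  measurable_fun (Omega : set (borelRn R d)) phi /\
  (lebesgue_Rn R d).-integrable Omega (fun x => (phi x ^+ 2)%:E).

Definition pd (i : 'I_d) phi : 'rV[R]_d -> R :=
  fun x => 'D_(delta_mx 0 i) phi x.

Definition iter_pd (s : seq 'I_d) phi : 'rV[R]_d -> R := foldr pd phi s.

Definition smooth phi : Prop :=
  forall s : seq 'I_d, continuous (iter_pd s phi) /\
    forall i x, derivable (iter_pd s phi) x (delta_mx 0 i).

Definition test_function Omega eta : Prop :=
  [/\ smooth eta, compact (closure [set x | eta x != 0])
    & closure [set x | eta x != 0] `<=` Omega].

Definition is_weak_pd Omega (i : 'I_d) phi g : Prop :=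
  forall eta, test_function Omega eta ->
    ip Omega phi (pd i eta) = - ip Omega g eta.

(* An L^2 representative of the weak partial derivative, unique up to null
   sets when it exists; [weak_pd] is only meaningful under [H1]. *)
Definition weak_pd Omega (i : 'I_d) phi : 'rV[R]_d -> R :=
  xget (fun=> 0) [set g | L2 Omega g /\ is_weak_pd Omega i phi g].

Definition H1 Omega phi : Prop :=
  L2 Omega phi /\ forall i, exists g, L2 Omega g /\ is_weak_pd Omega i phi g.

Definition H2 Omega phi : Prop :=
  H1 Omega phi /\ forall i, H1 Omega (weak_pd Omega i phi).

(* (grad phi, grad psi) *)
Definition gip Omega phi psi : R :=
  \sum_i ip Omega (weak_pd Omega i phi) (weak_pd Omega i psi).

Definition H1_norm Omega phi : R :=
  Num.sqrt (ip Omega phi phi + gip Omega phi phi).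

(* closure of C_c^oo(Omega) in H^1(Omega) *)
Definition H10 Omega phi : Prop :=
  H1 Omega phi /\ forall e : R, 0 < e ->
    exists eta, test_function Omega eta /\
      H1_norm Omega (fun x => phi x - eta x) < e.

Definition laplacian Omega phi : 'rV[R]_d -> R :=
  fun x => \sum_i weak_pd Omega i (weak_pd Omega i phi) x.

Definition normalize Omega phi : 'rV[R]_d -> R :=
  fun x => phi x / nrm Omega phi.

End function_spaces.

Section domain.
Context {R : realType} {d : nat}.
Implicit Types (Omega : set 'rV[R]_d).

Definition boundary Omega : set 'rV[R]_d := closure Omega `\` Omega°.

(* Near each boundary point, Omega is the region on one side of the graph of a
   smooth function of the other d - 1 coordinates (up to the choice of the
   coordinate j and of the orientation b of its axis). *)
Definition smooth_boundary Omega : Prop :=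
  forall x, boundary Omega x ->
  exists (r : R) (j : 'I_d) (b : bool) (g : 'rV[R]_d.-1 -> R),
    [/\ 0 < r, smooth g
      & forall y, ball x r y -> Omega y <-> g (col' j y) < (-1) ^+ b * y 0 j].

Definition smooth_bounded_domain Omega : Prop :=
  [/\ Omega !=set0, open Omega, connected Omega, bounded_set Omega
    & smooth_boundary Omega].

End domain.

Section finite_elements.
Context {R : realType} {d : nat}.
Implicit Types (Omega A : set 'rV[R]_d) (K : 'M[R]_(d.+1, d))
  (Th : seq 'M[R]_(d.+1, d)).

(* Euclidean norm; the library norm of 'rV[R]_d is the sup norm *)
Definition enorm (x : 'rV[R]_d) : R := Num.sqrt (\sum_i x 0 i ^+ 2).

Definition diam A : R :=
  sup [set r | exists x y, [/\ A x, A y & r = enorm (x - y)]].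

(* A simplex is given by the matrix K whose d+1 rows are its vertices;
   [face K I] is the closed face spanned by the vertices indexed by I. *)
Definition face K (I : {set 'I_d.+1}) : set 'rV[R]_d :=
  [set x | exists l : 'rV[R]_d.+1,
    [/\ forall i, 0 <= l 0 i, forall i, i \notin I -> l 0 i = 0,
        \sum_i l 0 i = 1 & x = l *m K]].

Definition simplex K : set 'rV[R]_d := face K [set: 'I_d.+1].

Definition nondegenerate K : Prop :=
  row_free (row_mx (const_mx 1 : 'cV[R]_d.+1) K).

Definition mesh_region Th : set 'rV[R]_d :=
  [set x | exists2 K, K \in Th & simplex K x].

Definition triangulation Omega Th : Prop :=
  [/\ forall K, K \in Th -> nondegenerate K,
      mesh_region Th `<=` closure Omega
    & forall K K', K \in Th -> K' \in Th -> K <> K' ->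
        exists I I' : {set 'I_d.+1},
          [/\ I != [set: 'I_d.+1]%SET, I' != [set: 'I_d.+1]%SET,
              simplex K `&` simplex K' = face K I & face K I = face K' I']].

Definition mesh_size Th : R := \big[Num.max/0]_(K <- Th) diam (simplex K).

Definition quasi_uniform (kappa : R) Th : Prop :=
  forall K, K \in Th -> exists x, forall y,
    enorm (y - x) <= kappa * mesh_size Th -> simplex K y.

(* A domain with curved boundary is not a union of simplices.  As usual for
   linear elements on such domains, the mesh is contained in the closure of
   Omega and covers it up to a boundary layer of width O(h^2), where the finite
   element functions are extended by 0 (see [fe_space]). *)
Definition covers_up_to_skin (kappa : R) Omega Th : Prop :=
  forall x, Omega x -> ~ mesh_region Th x ->
    exists2 y, boundary Omega y & enorm (x - y) <= kappa^-1 * mesh_size Th ^+ 2.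

Definition quasi_uniform_partition (kappa h : R) Omega Th : Prop :=
  [/\ triangulation Omega Th, mesh_size Th = h, quasi_uniform kappa Th
    & covers_up_to_skin kappa Omega Th].

Definition affine_on A (chi : 'rV[R]_d -> R) : Prop :=
  exists (a : 'cV[R]_d) (b : R), forall x, A x -> chi x = (x *m a) 0 0 + b.

Definition fe_space Omega Th : set ('rV[R]_d -> R) :=
  [set chi | [/\ H10 Omega chi, continuous chi,
      forall K, K \in Th -> affine_on (simplex K) chi
    & forall x, ~ mesh_region Th x -> chi x = 0]].

Definition elliptic_projection Omega Th
    (P : ('rV[R]_d -> R) -> ('rV[R]_d -> R)) : Prop :=
  forall g, H10 Omega g -> fe_space Omega Th (P g) /\
    forall chi, fe_space Omega Th chi ->
      gip Omega (fun x => g x - P g x) chi = 0.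

End finite_elements.

Section problem.
Context {R : realType} {d : nat}.
Implicit Types (Omega : set 'rV[R]_d) (u v phi psi : 'rV[R]_d -> R).

Definition locally_lipschitz (f : R -> R) : Prop :=
  forall x : R, exists (r L : R), 0 < r /\
    forall y z, ball x r y -> ball x r z -> `|f y - f z| <= L * `|y - z|.

Definition Fu Omega (f : R -> R) u : 'rV[R]_d -> R :=
  fun x => laplacian Omega u x + f (u x).

Definition Fv Omega (f : R -> R) u v : 'rV[R]_d -> R :=
  fun x => laplacian Omega v x + derive1 f (u x) * v x.

(* w_t(t) = g in L^2(Omega), for w : [0, T] -> L^2(Omega) (one-sided at T) *)
Definition has_time_derivative Omega (T : R) (w : R -> 'rV[R]_d -> R)
    (t : R) (g : 'rV[R]_d -> R) : Prop :=
  nrm Omega (fun x => (w s x - w t x) / (s - t) - g x)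
    @[s --> within [set` `[0, T]] t^'] --> (0 : R).

Definition continuous_at0 Omega (w : R -> 'rV[R]_d -> R) : Prop :=
  nrm Omega (fun x => w t x - w 0 x) @[t --> 0^'+] --> (0 : R).

(* Strong solution: the equations hold in L^2(Omega) for 0 < t <= T, the initial
   conditions are attained continuously in L^2(Omega), and the boundary
   conditions are expressed by membership in H^1_0(Omega). *)
Definition strong_solution Omega (beta gamma T : R) (f : R -> R)
    (u0 v0 : 'rV[R]_d -> R) (u v : R -> 'rV[R]_d -> R) : Prop :=
  [/\ forall t, 0 <= t <= T ->
        [/\ H2 Omega (u t), H10 Omega (u t), H2 Omega (v t) & H10 Omega (v t)],
      eq_L2 Omega (u 0) u0 /\ eq_L2 Omega (v 0) v0,
      continuous_at0 Omega u /\ continuous_at0 Omega v,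
      forall t, 0 < t <= T -> has_time_derivative Omega T u t
        (fun x => beta * (Fu Omega f (u t) x
           - 2 * v t x * ip Omega (v t) (Fu Omega f (u t))))
    & forall t, 0 < t <= T -> has_time_derivative Omega T v t
        (fun x => gamma * (Fv Omega f (u t) (v t) x
           - v t x * ip Omega (v t) (Fv Omega f (u t) (v t))))].

(* One step of the scheme, from (u, v) = (u_h^{n-1}, v_h^{n-1}) to
   (u', v's) = (u_h^n, v_h^{*,n}). *)
Definition scheme_u Omega Sh (beta tau : R) (f : R -> R) u v u' : Prop :=
  forall chi, Sh chi ->
    beta^-1 * ip Omega (fun x => (u' x - u x) / tau) chi + gip Omega u' chi
      - 2 * ip Omega v chi * gip Omega v u'
    = ip Omega (f \o u) chi - 2 * ip Omega v chi * ip Omega (f \o u) v.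

Definition scheme_v Omega Sh (gamma tau : R) (f : R -> R) u v v's : Prop :=
  let f'uv := fun x => derive1 f (u x) * v x in
  forall chi, Sh chi ->
    gamma^-1 * ip Omega (fun x => (v's x - v x) / tau) chi + gip Omega v's chi
      - ip Omega v chi * gip Omega v v's
    = ip Omega f'uv chi - ip Omega v chi * ip Omega f'uv v.

(* Testing [scheme_v] with chi = v_h^{n-1} gives (v_h^{n-1}, v_h^{*,n}) = 1, so
   that the division in [normalize] is by a nonzero number. *)
Definition fully_discrete_scheme Omega (Sh : set ('rV[R]_d -> R))
    (P : ('rV[R]_d -> R) -> ('rV[R]_d -> R)) (beta gamma T : R) (f : R -> R)
    (u0 v0 : 'rV[R]_d -> R) (N : nat)
    (uh vhs vh : nat -> 'rV[R]_d -> R) : Prop :=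
  let tau := T / N%:R in
  [/\ uh 0%N = P u0, vhs 0%N = normalize Omega (P v0), vh 0%N = vhs 0%N
    & forall n, (0 < n <= N)%N ->
      [/\ Sh (uh n) /\ scheme_u Omega Sh beta tau f (uh n.-1) (vh n.-1) (uh n),
          Sh (vhs n) /\ scheme_v Omega Sh gamma tau f (uh n.-1) (vh n.-1) (vhs n)
        & Sh (vh n) /\ vh n = normalize Omega (vhs n)]].

End problem.

(* Main.v *)
Require Import Defs.
From mathcomp Require Import all_boot all_order all_algebra.
From mathcomp Require Import all_classical all_reals all_analysis.
From mathcomp Require Import measurable_realfun ring lra.

Import Order.TTheory GRing.Theory Num.Theory.
Import numFieldNormedType.Exports.

Local Open Scope classical_set_scope.
Local Open Scope ring_scope.

(** For the unit vectors [a = Pvn] and [c = vh n] and [s = (a, c)] one has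
    [`|a - c|^2 = 2 - 2 s], while the vector [vhs n] lies on the line spanned
    by [c], whose distance to [a] is [sqrt (1 - s^2)].  So the claim is a
    comparison between a chord of the unit circle and the distance from its
    end [a] to the line through the centre and the other end [c].  The
    hypothesis [(a, a - c) <= 1] says [0 <= s]: the angle between [a] and [c]
    is at most a right angle, and there the chord is at most [y + y^3] as soon
    as [1 - s^2 <= y^2] ([chord_le]).

    What remains is the Hilbert space structure behind this picture: on
    [L2 Omega] the form [ip] is finite, symmetric and bilinear, and it is
    definite modulo null sets, so that [normalize] produces a unit vector from
    every function that is not a.e. zero.  For [n = 0] both discrete functions
    agree and the inequality is trivial. *)

(** * The plane geometry *)

(** [(1 - s) * (1 + s) <= y^2] is turned into
    [2 * (1 - s) <= y^2 * (1 + y^2)^2] by monotonicity in [y^2] and the bound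
    [2 <= (1 + s) * (2 - s^2)^2] on [[0, 1]]. *)
Lemma chord_le (R : realFieldType) (x y s : R) : 0 <= y -> 0 <= s ->
  x ^+ 2 = 2 - 2 * s -> 1 - s ^+ 2 <= y ^+ 2 -> x <= y + y ^+ 3.
Proof.
move=> y0 s0 xs ys.
have x2_ge0 : 0 <= x ^+ 2 := sqr_ge0 x.
have s1 : s <= 1 by lra.
have y30 : 0 <= y ^+ 3 by rewrite exprn_ge0.
(* since [s <= 1], the base [2 - s^2] is at least [2 - s] and at least [1] *)
have base_ge : 2 <= (1 + s) * (2 - s ^+ 2) ^+ 2.
  have e1 : 1 <= 2 - s ^+ 2 by nra.
  have e2 : 2 <= (1 + s) * (2 - s ^+ 2) by nra.
  nra.
have mono : (1 - s ^+ 2) * (2 - s ^+ 2) ^+ 2 <= y ^+ 2 * (1 + y ^+ 2) ^+ 2.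
  apply: ler_pM => //; [nra | exact: sqr_ge0 |].
  by rewrite lerXn2r ?nnegrE //; nra.
have [x0|x0] := leP 0 x; last by lra.
rewrite -(ler_pXn2r (n := 2)) ?nnegrE ?addr_ge0 //.
have -> : (y + y ^+ 3) ^+ 2 = y ^+ 2 * (1 + y ^+ 2) ^+ 2 by ring.
rewrite xs; apply: le_trans mono.
nra.
Qed.

(** * The inner product of L2 *)

Section inner_product.
Context {R : realType} {d : nat} {Omega : set 'rV[R]_d}.
Hypothesis oOmega : open Omega.
Implicit Types phi psi a b : 'rV[R]_d -> R.

Let mu : measure (borelRn R d) R := lebesgue_Rn R d.

Lemma measurable_open_borelRn : measurable (Omega : set (borelRn R d)).
Proof. exact: sub_sigma_algebra. Qed.
Let mOmega := measurable_open_borelRn.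

Lemma ipC phi psi : ip Omega phi psi = ip Omega psi phi.
Proof. by apply: eq_Rintegral => x _; rewrite mulrC. Qed.

Lemma ip_ge0 phi : 0 <= ip Omega phi phi.
Proof. by apply: Rintegral_ge0 => x _; rewrite -expr2 sqr_ge0. Qed.

Lemma sqr_nrm phi : nrm Omega phi ^+ 2 = ip Omega phi phi.
Proof. by rewrite sqr_sqrtr ?ip_ge0. Qed.

(** The pointwise bound [|phi psi| <= phi^2 + psi^2] makes [ip] finite. *)
Lemma L2_integrableM phi psi : L2 Omega phi -> L2 Omega psi ->
  mu.-integrable Omega (EFin \o (fun x => phi x * psi x)).
Proof.
move=> [mphi iphi] [mpsi ipsi].
apply: le_integrable (integrableD mOmega iphi ipsi) => //.
  apply/measurable_EFinP; exact: measurable_funM.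
move=> x _ /=; rewrite lee_fin [leRHS]ger0_norm ?addr_ge0 ?sqr_ge0 //.
by rewrite ler_norml; apply/andP; split; nra.
Qed.

Lemma L2Zr phi k : L2 Omega phi -> L2 Omega (fun x => phi x * k).
Proof.
move=> [mphi iphi]; split; first exact: measurable_funM.
have := integrableZl mOmega (k ^+ 2) iphi; apply: eq_integrable => // x _.
by rewrite exprMn mulrC.
Qed.

Lemma ipZr phi psi k : L2 Omega phi -> L2 Omega psi ->
  ip Omega phi (fun x => psi x * k) = ip Omega phi psi * k.
Proof.
move=> Lphi Lpsi.
rewrite /ip -(RintegralZr _ mOmega (L2_integrableM _ _ Lphi Lpsi)).
by apply: eq_Rintegral => x _; rewrite mulrA.
Qed.

Lemma L2B phi psi : L2 Omega phi -> L2 Omega psi ->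
  L2 Omega (fun x => phi x - psi x).
Proof.
move=> Lphi Lpsi; have ipp := L2_integrableM _ _ Lphi Lpsi.
move: Lphi Lpsi => [mphi iphi] [mpsi ipsi].
split; first exact: measurable_funB.
have := integrableD mOmega (integrableD mOmega iphi ipsi)
  (integrableZl mOmega (- 2) ipp).
apply: eq_integrable => // x _ /=.
by rewrite -EFinM -!EFinD; congr EFin; ring.
Qed.

Lemma ipBr phi a b : L2 Omega phi -> L2 Omega a -> L2 Omega b ->
  ip Omega phi (fun x => a x - b x) = ip Omega phi a - ip Omega phi b.
Proof.
move=> Lphi La Lb.
rewrite /ip -(RintegralB mOmega (L2_integrableM _ _ Lphi La)
  (L2_integrableM _ _ Lphi Lb)).
by apply: eq_Rintegral => x _; rewrite mulrBr.
Qed.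

Lemma ip_sub_sub a b : L2 Omega a -> L2 Omega b ->
  ip Omega (fun x => a x - b x) (fun x => a x - b x)
  = ip Omega a a - 2 * ip Omega a b + ip Omega b b.
Proof.
move=> La Lb; have Lab := L2B _ _ La Lb.
rewrite ipBr // ipC ipBr // [in X in _ - X]ipC ipBr // (ipC b a); ring.
Qed.

(** The quadratic [k |-> `|a - k b|^2] is affine when [`|b| = 0], and an affine
    function that is bounded below is constant. *)
Lemma ip_eq0 a b : L2 Omega a -> L2 Omega b ->
  ip Omega b b = 0 -> ip Omega a b = 0.
Proof.
move=> La Lb b0; apply/eqP/negPn/negP => t0.
pose k := (ip Omega a a + 1) / (2 * ip Omega a b).
have Lbk := L2Zr _ k Lb.
have := ip_ge0 (fun x => a x - b x * k).
rewrite ip_sub_sub // ipZr // ipZr // (ipC (fun x => b x * k)) ipZr // b0 !mul0r.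
have -> : 2 * (ip Omega a b * k) = ip Omega a a + 1 by rewrite /k; field.
by lra.
Qed.

(** A nonnegative function with zero integral vanishes a.e. *)
Lemma nrm_neq0 phi : L2 Omega phi -> ~ eq_L2 Omega phi (fun=> 0) ->
  nrm Omega phi != 0.
Proof.
move=> [mphi iphi] phiN0; apply/negP => /eqP nphi0; apply: phiN0.
have int0 : (\int[mu]_(x in Omega) `|(phi x ^+ 2)%:E| = 0)%E.
  under eq_integral do rewrite gee0_abs ?lee_fin ?sqr_ge0 //.
  rewrite -[LHS]fineK ?(integrable_fin_num mOmega iphi) //.
  congr EFin; transitivity (ip Omega phi phi); last by rewrite -sqr_nrm nphi0 expr0n.
  by apply: eq_Rintegral => x _.
have /(ae_eq_integral_abs mu mOmega) := int0.
case/integrableP : iphi => m2 _ /(_ m2).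
apply: filterS => x /= phi0 Ox; have [] := phi0 Ox.
by move/eqP; rewrite sqrf_eq0 => /eqP.
Qed.

Lemma nrm_normalize phi : L2 Omega phi -> nrm Omega phi != 0 ->
  nrm Omega (normalize Omega phi) = 1.
Proof.
move=> Lphi phi0; have Lk := L2Zr _ (nrm Omega phi)^-1 Lphi.
rewrite {1}/nrm /normalize ipZr // ipC ipZr // -sqr_nrm.
by rewrite -mulrA -invfM -expr2 divff ?sqrf_eq0 // sqrtr1.
Qed.

(** When [b] is a.e. zero, division by zero makes [normalize Omega b] the zero
    function: both distances are then [1]. *)
Lemma nrm_sub_normalize_le a b : L2 Omega a -> L2 Omega b ->
  nrm Omega a = 1 -> ip Omega a (fun x => a x - normalize Omega b x) <= 1 ->
  nrm Omega (fun x => a x - normalize Omega b x)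
    <= nrm Omega (fun x => a x - b x) + nrm Omega (fun x => a x - b x) ^+ 3.
Proof.
move=> La Lb a1; set r := nrm Omega b; set t := ip Omega a b.
have Lc : L2 Omega (normalize Omega b) by exact: L2Zr.
have aa : ip Omega a a = 1 by rewrite -sqr_nrm a1 expr1n.
have ac : ip Omega a (normalize Omega b) = t / r by rewrite ipZr.
have cc : ip Omega (normalize Omega b) (normalize Omega b) = (r / r) ^+ 2.
  rewrite [LHS]ipZr // ipC ipZr // -sqr_nrm -/r; ring.
have := sqr_nrm (fun x => a x - b x).
have := sqr_nrm (fun x => a x - normalize Omega b x).
rewrite (ipBr a) // !ip_sub_sub // aa ac cc -(sqr_nrm b) -/r -/t.
set x := nrm Omega _; set y := nrm Omega _ => x2 y2 st.
have x0 : 0 <= x by exact: sqrtr_ge0.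
have y0 : 0 <= y by exact: sqrtr_ge0.
have [r0|rn0] := eqVneq r 0.
  have t0 : t = 0 by apply: ip_eq0 => //; rewrite -sqr_nrm -/r r0 expr0n.
  move: x2 y2; rewrite r0 t0 !mul0r !mulr0 => x2 y2.
  have x1 : x = 1 by nra.
  have y1 : y = 1 by nra.
  by rewrite x1 y1; lra.
have tE : t = t / r * r by rewrite divfK.
apply: (@chord_le _ x y (t / r)) => //; first by lra.
  by rewrite x2 divff //; ring.
(* the distance from [a] to the line is minimal at the foot [s c]:
   the gap is [(r - s)^2] *)
rewrite y2 [in leRHS]tE -subr_ge0.
have -> : 1 - 2 * (t / r * r) + r ^+ 2 - (1 - (t / r) ^+ 2) = (r - t / r) ^+ 2.
  by ring.
exact: sqr_ge0.
Qed.

End inner_product.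

(** * Errors before and after normalization *)

Theorem lemma4p2 (R : realType) (d : nat) (hd : (1 <= d <= 3)%N)
  (Omega : set 'rV[R]_d) (hOmega : smooth_bounded_domain Omega)
  (beta gamma T : R) (hbeta : 0 < beta) (hgamma : 0 < gamma) (hT : 0 < T)
  (f : R -> R) (hf : forall x, derivable f x 1)
  (hfL : locally_lipschitz f) (hf'L : locally_lipschitz (derive1 f))
  (u0 v0 : 'rV[R]_d -> R)
  (hu0 : H2 Omega u0 /\ H10 Omega u0) (hv0 : H2 Omega v0 /\ H10 Omega v0)
  (hv01 : nrm Omega v0 = 1)
  (u v : R -> 'rV[R]_d -> R)
  (huv : strong_solution Omega beta gamma T f u0 v0 u v)
  (kappa h : R) (hkappa : 0 < kappa) (hh : 0 < h)
  (Th : seq 'M[R]_(d.+1, d)) (hTh : quasi_uniform_partition kappa h Omega Th)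
  (P : ('rV[R]_d -> R) -> ('rV[R]_d -> R)) (hP : elliptic_projection Omega Th P)
  (N : nat) (hN : (0 < N)%N)
  (hPv : forall m, (m <= N)%N ->
    ~ eq_L2 Omega (P (v (m%:R * (T / N%:R)))) (fun=> 0))
  (uh vhs vh : nat -> 'rV[R]_d -> R)
  (hscheme : fully_discrete_scheme Omega (fe_space Omega Th) P
    beta gamma T f u0 v0 N uh vhs vh)
  (n : nat) (hn : (n <= N)%N) :
  let Pvn := normalize Omega (P (v (n%:R * (T / N%:R)))) in
  let xi := fun x => Pvn x - vh n x in
  let xis := fun x => Pvn x - vhs n x in
  ip Omega Pvn xi <= 1 ->
  nrm Omega xi <= nrm Omega xis + nrm Omega xis ^+ 3.
Proof.
move=> Pvn xi xis; have [_ _ vh0 step] := hscheme.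
case: n hn @Pvn @xi @xis => [|n] hn Pvn xi xis.
  rewrite /xi /xis vh0 => _.
  by rewrite lerDl exprn_ge0 // sqrtr_ge0.
have [_ oOmega _ _ _] := hOmega.
have [_ [[[[Lvhs _] _] _ _ _] _] [_ vhE]] := step n.+1 hn.
have tn : 0 <= n.+1%:R * (T / N%:R) <= T.
  have N0 : 0 < N%:R :> R by rewrite ltr0n.
  apply/andP; split; first by rewrite mulr_ge0 ?divr_ge0 ?ltW.
  by rewrite mulrA ler_pdivrMr // mulrC ler_pM2l // ler_nat.
have [sol _ _ _ _] := huv.
have [_ _ _ H10v] := sol _ tn.
have [[[[LPv _] _] _ _ _] _] := hP _ H10v.
rewrite /xi /xis vhE; apply: nrm_sub_normalize_le => //.
- exact: L2Zr.
- by apply: nrm_normalize => //; apply: nrm_neq0 => //; exact: hPv.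
Qed.
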